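(* Let $f:[0,1]\to\mathbb{R}$ be a $C^1$ function of type B, i.e. there is $u_0\in(0,1)$ with $f(u)=0$ for all $u\in[0,u_0]$, $f(u)>0$ for all $u\in(u_0,1)$ and $f(1)=0$. Let $h:[0,1]\to\mathbb{R}$ be a $C^1$ function with $h(0)=0$, $h'(u)>0$ for every $u\in(0,1)$, and $h(u_0)<1+h(0)$. Set $F^+=\int_{u_0}^1 f(u)\,du$ and fix $\eta>0$ with $\eta<\min\{F^+,1\}$. Then each of the following is a sufficient condition for the existence of a positive admissible speed, i.e. of some $c>0$ for which the problem $$\begin{cases} y'=(c+h'(u))\dfrac{\sqrt{y(2-y)}}{1-y}-f(u),\\ y(0)=0,\quad y(1)=0,\quad 0<y(u)<1\ \text{ for } u\in(0,1)\end{cases}$$ has a solution. 1) $F^+<1$ and $$h(u_0)-h(0)<\sqrt{1-(1+\eta-F^+)^2},\qquad h(1)-h(u_0)<\frac{1-F^+}{\sqrt{F^+(2-F^+)}}\,\eta .$$ 2) $F^+\ge 1$ and, for fixed constants $\kappa$ with $0<\kappa<\eta$ and $\xi_0\in(u_0,1)$ such that $\int_{\xi_0}^1 f(u)\,du=1-\kappa$, $$h(u_0)-h(0)<\sqrt{1-\eta^2},\qquad h(\xi_0)-h(u_0)<\sqrt{1-\Big(\frac{\kappa+\eta}{2}\Big)^2}-\sqrt{1-\eta^2},$$ $$h(1)-h(\xi_0)<\frac{\eta-\kappa}{2}\,\frac{\kappa}{\sqrt{1-\kappa^2}} .$$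
   Context: A solution is a function $y$, continuous on $[0,1]$, satisfying the differential equation on $(0,1)$ together with the stated boundary conditions and bounds. A speed $c\in\mathbb{R}$ is called admissible if the displayed first-order two-point problem is solvable. *)

(* Defs.v *)
From Stdlib Require Import Reals.
From Coquelicot Require Import Coquelicot.

Open Scope R_scope.

(** Functions on [0,1] are represented by total functions [R -> R]; only their
    values on [0,1] are ever constrained. *)
Definition I01 (u : R) : Prop := 0 <= u <= 1.

(** [D_in] is differentiability relative to [I01], hence one-sided at 0 and 1.
    On (0,1) the witness [df] agrees with [Derive g]. *)
Definition C1_01 (g : R -> R) : Prop :=
  exists df : R -> R,
    (forall u, I01 u -> D_in g df I01 u) /\ continuous_on I01 df.

Definition type_B (f : R -> R) (u0 : R) : Prop :=
  0 < u0 < 1 /\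
  (forall u, 0 <= u <= u0 -> f u = 0) /\
  (forall u, u0 < u < 1 -> 0 < f u) /\
  f 1 = 0.

Definition is_solution (h f : R -> R) (c : R) (y : R -> R) : Prop :=
  continuous_on I01 y /\
  (forall u, 0 < u < 1 ->
     is_derive y u
       ((c + Derive h u) * (sqrt (y u * (2 - y u)) / (1 - y u)) - f u)) /\
  y 0 = 0 /\ y 1 = 0 /\
  (forall u, 0 < u < 1 -> 0 < y u < 1).

Definition admissible (h f : R -> R) (c : R) : Prop :=
  exists y : R -> R, is_solution h f c y.

Definition Fplus (f : R -> R) (u0 : R) : R := RInt f u0 1.

(* Main.v *)
Require Import Defs.
From Stdlib Require Import Reals Lra ClassicalEpsilon.
From Coquelicot Require Import Coquelicot.
Open Scope R_scope.

(** Write [y] as the versine of an angle [t], so that [sqrt (y (2 - y))] is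
    [sin t] and the singular factor [sqrt (y (2 - y)) / (1 - y)] is [tan t].
    Two facts drive the proof.

    Run backward from [y 1 = 0], the equation is dissipative: the tangent is a
    nondecreasing function of [y] and its coefficient [c + h'] is nonnegative,
    so two backward solutions cannot drift apart
    ([backward_comparison], [backward_stability]).  This gives at once
    uniqueness, Lipschitz dependence on [c] and all the barrier arguments, in
    spite of the square root singularity at [y = 0], which rules out any
    Lipschitz theory.  It also gives existence, once the tangent is cut off
    away from [y = 1]: solutions of the equation with a delayed argument are
    built by successive integrations, and dissipativity makes them converge
    uniformly ([backward_solution_exists]).

    On [[0, u0]], where [f] vanishes, the derivative of the sine is exactly
    [c + h'], so a solution starting from [0] has sine [c u + h u].

    Hence a speed [c] is admissible as soon as the backward solution [y_c]
    stays below the cut-off and its sine at [u0] is [c u0 + h u0].  The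
    cut-off is never exceeded on [[u0, 1]], uniformly in [c >= 0]
    ([truncated_solution_le_cap]).  The matching condition is solved by the
    intermediate value theorem ([positive_speed_exists]).  For the [c] that
    makes the explicit branch reach the cut-off at [u0], the backward solution
    is below it.  For [c = 0] it must be strictly above it, and this is what
    the smallness conditions on [h] ensure: if [P], the integral of [f] over
    [[xi, 1]], is less than 1, then [y_0 u <= P] on [[xi, 1]], so that
    [y_0 xi] is at least [v = P - (h 1 - h xi) tan], the tangent being taken at
    versine [P]; to the left of [xi] the sine grows at rate at most [h'], so
    it is enough that [h xi] be less than the sine at versine [v]
    ([zero_speed_lower_bound]).  The first condition of the theorem is the
    case [xi = u0], the second one the case [xi = xi0]. *)

(** * Truncation and elementary analysis *)

Definition clamp (a b x : R) : R := Rmax a (Rmin x b).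

Lemma clamp_in a b x : a <= b -> a <= clamp a b x <= b.
Proof.
intros H; unfold clamp, Rmax, Rmin; repeat destruct Rle_dec; lra.
Qed.

Lemma clamp_id a b x : a <= x <= b -> clamp a b x = x.
Proof.
intros H; unfold clamp, Rmax, Rmin; repeat destruct Rle_dec; lra.
Qed.

Lemma clamp_le a b x y : x <= y -> clamp a b x <= clamp a b y.
Proof.
intros H; unfold clamp, Rmax, Rmin; repeat destruct Rle_dec; lra.
Qed.

Lemma clamp_lip a b x y : Rabs (clamp a b x - clamp a b y) <= Rabs (x - y).
Proof.
unfold clamp, Rmax, Rmin, Rabs;
  repeat destruct Rle_dec; repeat destruct Rcase_abs; lra.
Qed.

Lemma lipschitz_continuous (k : R) (f : R -> R) :
  (forall x y, Rabs (f x - f y) <= k * Rabs (x - y)) ->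
  forall x, continuous f x.
Proof.
intros Hf x; apply continuity_pt_filterlim; intros e He.
assert (Hk : 0 < Rabs k + 1) by (pose proof (Rabs_pos k); lra).
exists (e / (Rabs k + 1)); split; [now apply Rdiv_lt_0_compat|].
intros y [_ Hy]; simpl in *; unfold R_dist in *.
apply Rle_lt_trans with (1 := Hf y x).
apply Rlt_div_r in Hy; auto.
pose proof (Rabs_pos (y - x)); pose proof (Rle_abs k); nra.
Qed.

Lemma clamp_continuous (a b x : R) : continuous (clamp a b) x.
Proof.
apply lipschitz_continuous with 1; intros y z; rewrite Rmult_1_l; apply clamp_lip.
Qed.

Lemma continuous_clamp_comp (g : R -> R) :
  continuous_on I01 g -> forall u, continuous (fun x => g (clamp 0 1 x)) u.
Proof.
intros Hg u.
apply filterlim_comp with (G := within I01 (locally (clamp 0 1 u))).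
- intros P HP; unfold within in HP.
  generalize (clamp_continuous 0 1 u _ HP); unfold filtermap.
  apply filter_imp; intros x Hx; apply Hx; apply clamp_in; lra.
- apply Hg, clamp_in; lra.
Qed.

Lemma bounded_on_segment (g : R -> R) a b :
  a <= b -> (forall u, continuous g u) ->
  exists M, 0 <= M /\ forall u, a <= u <= b -> Rabs (g u) <= M.
Proof.
intros Hab Hg.
destruct (continuity_ab_maj (fun u => Rabs (g u)) a b Hab) as [m [Hm _]].
- intros u _; apply continuity_pt_filterlim.
  apply (continuous_comp g Rabs); auto; apply continuous_Rabs.
- exists (Rabs (g m)); split; auto; apply Rabs_pos.
Qed.

(** The square smooths the corner of the positive part, so that derivative
    arguments can be localised on the set where a function is positive. *)
Lemma is_derive_sq_pos_part x :
  is_derive (fun t => Rmax t 0 ^ 2) x (2 * Rmax x 0).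
Proof.
destruct (Rtotal_order x 0) as [Hx|[Hx|Hx]].
- apply is_derive_ext_loc with (fun _ => 0).
  + apply filter_imp with (2 := open_lt 0 x Hx).
    intros t Ht; rewrite Rmax_right by lra; simpl; now rewrite Rmult_0_l.
  + rewrite Rmax_right by lra; rewrite Rmult_0_r; apply @is_derive_const.
- subst x; apply is_derive_Reals; intros e He; exists (mkposreal e He).
  intros t Ht Hte; simpl in Hte.
  rewrite Rplus_0_l, (Rmax_left 0 0) by lra.
  apply Rle_lt_trans with (2 := Hte); unfold Rmax; destruct Rle_dec.
  + replace ((0 ^ 2 - 0 ^ 2) / t - 2 * 0) with 0 by (field; auto).
    rewrite Rabs_R0; apply Rabs_pos.
  + right; f_equal; field; auto.
- apply is_derive_ext_loc with (fun t => t ^ 2).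
  + apply filter_imp with (2 := open_gt 0 x Hx).
    intros t Ht; now rewrite Rmax_left by lra.
  + rewrite Rmax_left by lra; auto_derive; auto; ring.
Qed.

(** * The backward comparison principle *)

(** If [y] exceeded the barrier [z u + e (b - u)] somewhere, the gap would be
    nondecreasing wherever it is positive, hence could not return to its
    nonpositive value at [b].  Derivatives are compared only where [z < y],
    which is where a monotone nonlinearity has a known sign. *)
Lemma backward_comparison (y z y' z' : R -> R) (a b e : R) :
  0 <= e ->
  (forall u, a <= u <= b -> continuous y u) ->
  (forall u, a <= u <= b -> continuous z u) ->
  (forall u, a < u < b -> is_derive y u (y' u)) ->
  (forall u, a < u < b -> is_derive z u (z' u)) ->
  y b <= z b ->
  (forall u, a < u < b -> z u < y u -> z' u - e <= y' u) ->
  forall u, a <= u <= b -> y u <= z u + e * (b - u).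
Proof.
intros He Cy Cz Dy Dz Hb Hd u Hu.
set (D := fun t => y t - z t - e * (b - t)).
set (P := fun t => Rmax (D t) 0 ^ 2).
(* the outer [Rmax 0] matters only at the end points, where the mean value
   point may fall and nothing is assumed on the derivatives *)
set (P' := fun t => Rmax 0 (2 * Rmax (D t) 0 * (y' t - z' t + e))).
destruct (Req_dec u b) as [->|Hub]; [lra|].
assert (CD : forall t, a <= t <= b -> continuous D t).
{ intros t Ht; unfold D.
  apply (continuous_minus (fun t => y t - z t) (fun t => e * (b - t))).
  - apply (continuous_minus y z); auto.
  - apply @ex_derive_continuous; auto_derive; auto. }
destruct (MVT_gen P u b P') as [t [Ht Heq]].
- rewrite Rmin_left, Rmax_right by lra; intros t Ht.
  assert (Hpos : 0 <= 2 * Rmax (D t) 0 * (y' t - z' t + e)).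
  { unfold Rmax; destruct Rle_dec; [lra|].
    assert (0 <= e * (b - t)) by (apply Rmult_le_pos; lra).
    assert (z t < y t) by (unfold D in *; lra).
    specialize (Hd t ltac:(lra) ltac:(lra)).
    apply Rmult_le_pos; lra. }
  unfold P'; rewrite Rmax_right by exact Hpos.
  unfold P; rewrite Rmult_comm.
  apply (is_derive_comp (fun x => Rmax x 0 ^ 2) D t).
  + apply is_derive_sq_pos_part.
  + unfold D; replace (y' t - z' t + e) with (minus (minus (y' t) (z' t)) (- e))
      by (unfold minus, plus, opp; simpl; ring).
    apply @is_derive_minus; [apply @is_derive_minus|].
    * apply Dy; lra.
    * apply Dz; lra.
    * auto_derive; auto; ring.
- rewrite Rmin_left, Rmax_right by lra; intros t Ht.
  apply continuity_pt_filterlim; unfold P.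
  apply (continuous_comp D (fun x => Rmax x 0 ^ 2)).
  + apply CD; lra.
  + apply @ex_derive_continuous; eexists; apply is_derive_sq_pos_part.
- assert (Hb0 : P b = 0).
  { unfold P, D; rewrite Rmax_right; [ring|lra]. }
  assert (0 <= P' t * (b - u)).
  { apply Rmult_le_pos; [apply Rmax_l|lra]. }
  assert (Hu0 : Rmax (D u) 0 ^ 2 <= 0) by (fold (P u); lra).
  assert (D u <= 0).
  { pose proof (Rmax_l (D u) 0); nra. }
  unfold D in *; lra.
Qed.

Lemma backward_stability (y z y' z' : R -> R) (a b e : R) :
  0 <= e ->
  (forall u, a <= u <= b -> continuous y u) ->
  (forall u, a <= u <= b -> continuous z u) ->
  (forall u, a < u < b -> is_derive y u (y' u)) ->
  (forall u, a < u < b -> is_derive z u (z' u)) ->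
  y b = z b ->
  (forall u, a < u < b -> z u < y u -> z' u - e <= y' u) ->
  (forall u, a < u < b -> y u < z u -> y' u - e <= z' u) ->
  forall u, a <= u <= b -> Rabs (y u - z u) <= e * (b - u).
Proof.
intros He Cy Cz Dy Dz Hb H1 H2 u Hu.
assert (y u <= z u + e * (b - u))
  by (apply (backward_comparison y z y' z' a b); auto; lra).
assert (z u <= y u + e * (b - u))
  by (apply (backward_comparison z y z' y' a b); auto; lra).
apply Rabs_le; lra.
Qed.

Lemma lipschitz_of_derive_bound (y y' : R -> R) (a b L : R) :
  0 <= L ->
  (forall u, a <= u <= b -> continuous y u) ->
  (forall u, a < u < b -> is_derive y u (y' u)) ->
  (forall u, a < u < b -> Rabs (y' u) <= L) ->
  forall u v, a <= u <= b -> a <= v <= b ->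
  Rabs (y u - y v) <= L * Rabs (u - v).
Proof.
intros HL Cy Dy By.
assert (Hw : forall u v, a <= u <= b -> a <= v <= b -> u <= v ->
             Rabs (y u - y v) <= L * Rabs (u - v)).
{ intros u v Hu Hv Huv.
  rewrite (Rabs_left1 (u - v)) by lra; replace (- (u - v)) with (v - u) by ring.
  apply (backward_stability y (fun _ => y v) y' (fun _ => 0) u v L); auto; try lra.
  - intros t Ht; apply Cy; lra.
  - intros t _; apply continuous_const.
  - intros t Ht; apply Dy; lra.
  - intros t _; apply @is_derive_const.
  - intros t Ht _.
    specialize (By t ltac:(lra)); apply Rabs_le_between in By; lra.
  - intros t Ht _.
    specialize (By t ltac:(lra)); apply Rabs_le_between in By; lra. }
intros u v Hu Hv; destruct (Rle_dec u v) as [H|H]; auto.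
rewrite Rabs_minus_sym, (Rabs_minus_sym u); apply Hw; auto; lra.
Qed.

Lemma nondecreasing_of_derive_nonneg (h a : R -> R) :
  (forall u, continuous h u) ->
  (forall u, 0 < u < 1 -> is_derive h u (a u)) ->
  (forall u, 0 < u < 1 -> 0 <= a u) ->
  forall x y, 0 <= x -> x <= y -> y <= 1 -> h x <= h y.
Proof.
intros Ch Dh Pa x y Hx Hxy Hy.
enough (h x <= h y + 0 * (y - x)) by lra.
apply (backward_comparison h (fun _ => h y) a (fun _ => 0) x y 0); auto; try lra.
- intros; apply continuous_const.
- intros; apply Dh; lra.
- intros; apply @is_derive_const.
- intros t Ht _; generalize (Pa t ltac:(lra)); lra.
Qed.

Lemma is_derive_RInt_lower (g : R -> R) (b u : R) :
  (forall x, continuous g x) -> is_derive (fun u => RInt g u b) u (- g u).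
Proof.
intros Cg; apply (is_derive_RInt' (V := R_NormedModule) g _ u b); auto.
apply filter_forall; intros t; apply (RInt_correct (V := R_CompleteNormedModule)).
apply (ex_RInt_continuous (V := R_CompleteNormedModule)); auto.
Qed.

Lemma RInt_tail_le (F : R -> R) (a u : R) :
  (forall t, continuous F t) -> (forall t, 0 < t < 1 -> 0 <= F t) ->
  0 <= a -> a <= u -> u <= 1 -> RInt F u 1 <= RInt F a 1.
Proof.
intros CF PF Ha Hau Hu.
assert (HI : forall x y, ex_RInt F x y).
{ intros x y; apply (ex_RInt_continuous (V := R_CompleteNormedModule)); auto. }
rewrite <- (RInt_Chasles F a u 1) by auto.
enough (0 <= RInt F a u) by (unfold plus; simpl; lra).
apply RInt_ge_0; auto; intros t Ht; apply PF; lra.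
Qed.

(** * Solving the equation backward from the right end point *)

Definition delay_op (A F G : R -> R) (r : R) (y : R -> R) (u : R) : R :=
  RInt (fun s => F s - A s * G (y (Rmin (s + r) 1))) u 1.

Lemma delay_continuous (A F G y : R -> R) (r : R) :
  (forall u, continuous A u) -> (forall u, continuous F u) ->
  (forall u, continuous G u) -> (forall u, continuous y u) ->
  forall s, continuous (fun s => F s - A s * G (y (Rmin (s + r) 1))) s.
Proof.
intros CA CF CG Cy s.
apply (continuous_minus F (fun s => A s * G (y (Rmin (s + r) 1)))); auto.
apply (continuous_mult A (fun s => G (y (Rmin (s + r) 1)))); auto.
apply (continuous_comp (fun s => y (Rmin (s + r) 1)) G); auto.
apply (continuous_comp (fun s => Rmin (s + r) 1) y); auto.
apply lipschitz_continuous with 1; intros x x'.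
unfold Rmin, Rabs; repeat destruct Rle_dec; repeat destruct Rcase_abs; lra.
Qed.

(** Reading [y] at a later point [u + r] makes the equation explicit: known on
    the last [k] steps, the solution is obtained on one more step by an
    integration.  No regularity of [G] beyond continuity is used, and finitely
    many iterations reach [0]. *)
Lemma delay_solution_exists (A F G : R -> R) (r : R) :
  (forall u, continuous A u) -> (forall u, continuous F u) ->
  (forall u, continuous G u) -> 0 < r ->
  exists y : R -> R, (forall u, continuous y u) /\ y 1 = 0 /\
    forall u, 0 < u < 1 ->
      is_derive y u (A u * G (y (Rmin (u + r) 1)) - F u).
Proof.
intros CA CF CG Hr.
set (Y := fun k => Nat.iter k (delay_op A F G r) (fun _ => 0)).
assert (DY : forall k, (forall u, continuous (Y k) u) -> forall u,
    is_derive (Y (S k)) u (A u * G (Y k (Rmin (u + r) 1)) - F u)).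
{ intros k Ck u.
  replace (A u * G (Y k (Rmin (u + r) 1)) - F u)
    with (- (F u - A u * G (Y k (Rmin (u + r) 1)))) by ring.
  apply (is_derive_RInt_lower
           (fun s => F s - A s * G (Y k (Rmin (s + r) 1)))).
  intros s; apply delay_continuous; auto. }
assert (CY : forall k u, continuous (Y k) u).
{ induction k as [|k IH]; intros u; [apply continuous_const|].
  apply @ex_derive_continuous; eexists; apply DY, IH. }
assert (Y1 : forall k, Y k 1 = 0).
{ intros [|k]; [reflexivity|]; apply @RInt_point. }
(* the [k]-th iterate is already fixed on the last [k] steps of length [r] *)
assert (Hstab : forall k u, 0 <= u <= 1 -> 1 - INR k * r <= u ->
                Y (S k) u = Y k u).
{ induction k as [|k IH]; intros u Hu Hk.
  - simpl in Hk; replace u with 1 by lra; now rewrite !Y1.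
  - apply RInt_ext; rewrite Rmin_left, Rmax_right by lra; intros s Hs.
    change (F s - A s * G (Y (S k) (Rmin (s + r) 1))
            = F s - A s * G (Y k (Rmin (s + r) 1))).
    rewrite S_INR in Hk; rewrite IH; auto.
    + unfold Rmin; destruct Rle_dec; lra.
    + assert (0 <= INR k * r) by (apply Rmult_le_pos; [apply pos_INR|lra]).
      unfold Rmin; destruct Rle_dec; lra. }
destruct (nfloor_ex (/ r)) as [n [_ Hn]]; [left; now apply Rinv_0_lt_compat|].
assert (Hn1 : 1 <= INR (S n) * r).
{ rewrite S_INR; apply Rmult_lt_compat_r with (r := r) in Hn; auto.
  rewrite Rinv_l in Hn; lra. }
exists (Y (S (S n))); split; [|split]; auto.
intros u Hu; rewrite (Hstab (S n)).
- apply DY, CY.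
- unfold Rmin; destruct Rle_dec; lra.
- unfold Rmin; destruct Rle_dec; lra.
Qed.

Definition unif_continuous (G : R -> R) : Prop :=
  forall e, 0 < e -> exists d, 0 < d /\
    forall x y, Rabs (x - y) < d -> Rabs (G x - G y) <= e.

Lemma unif_continuous_continuous (G : R -> R) :
  unif_continuous G -> forall x, continuous G x.
Proof.
intros HG x; apply continuity_pt_filterlim; intros e He.
destruct (HG (e / 2)) as [d [Hd H]]; [lra|].
exists d; split; [lra|]; intros y [_ Hy]; simpl in *; unfold R_dist in *.
specialize (H y x Hy); lra.
Qed.

Definition approximate_solution (A F G : R -> R) (e : R) (y : R -> R) : Prop :=
  (forall u, continuous y u) /\ y 1 = 0 /\
  exists y' : R -> R, forall u, 0 < u < 1 ->
    is_derive y u (y' u) /\ Rabs (y' u - (A u * G (y u) - F u)) <= e.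

(** Delayed solutions are Lipschitz uniformly in the delay, so a short delay
    perturbs the argument of [G], hence [G] itself, only slightly. *)
Lemma approximate_solution_exists (A F G : R -> R) (B e : R) :
  (forall u, continuous A u) -> (forall u, continuous F u) ->
  unif_continuous G -> (forall x, Rabs (G x) <= B) -> 0 < e ->
  exists y, approximate_solution A F G e y.
Proof.
intros CA CF UG BG He.
destruct (bounded_on_segment A 0 1) as [K [HK BA]]; [lra|auto|].
destruct (bounded_on_segment F 0 1) as [M [HM BF]]; [lra|auto|].
destruct (UG (e / (K + 1))) as [d [Hd HG]]; [apply Rdiv_lt_0_compat; lra|].
assert (HB : 0 <= B) by (generalize (BG 0), (Rabs_pos (G 0)); lra).
assert (HL : 0 <= K * B) by now apply Rmult_le_pos.
set (L := K * B + M + 1).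
assert (Hr : 0 < d / (2 * L)) by (apply Rdiv_lt_0_compat; unfold L; lra).
set (r := d / (2 * L)) in *.
destruct (delay_solution_exists A F G r) as [y [Cy [y1 Dy]]]; auto.
{ now apply unif_continuous_continuous. }
exists y; split; [|split]; auto.
exists (fun u => A u * G (y (Rmin (u + r) 1)) - F u).
intros u Hu; split; auto.
assert (Hlip : Rabs (y (Rmin (u + r) 1) - y u)
               <= L * Rabs (Rmin (u + r) 1 - u)).
{ apply lipschitz_of_derive_bound with (a := 0) (b := 1) (3 := Dy); auto.
  - unfold L; lra.
  - intros t Ht; unfold L.
    apply Rle_trans with (1 := Rabs_triang _ _); rewrite Rabs_Ropp, Rabs_mult.
    assert (Rabs (A t) * Rabs (G (y (Rmin (t + r) 1))) <= K * B).
    { apply Rmult_le_compat; auto; try apply Rabs_pos; apply BA; lra. }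
    specialize (BF t ltac:(lra)); lra.
  - unfold Rmin; destruct Rle_dec; lra.
  - lra. }
assert (Hstep : Rabs (Rmin (u + r) 1 - u) <= r).
{ rewrite Rabs_right; unfold Rmin; destruct Rle_dec; lra. }
assert (Hd' : Rabs (y (Rmin (u + r) 1) - y u) < d).
{ assert (L * r = d / 2) by (unfold r; field; unfold L; lra).
  assert (L * Rabs (Rmin (u + r) 1 - u) <= L * r)
    by (apply Rmult_le_compat_l; auto; unfold L; lra).
  lra. }
replace (A u * G (y (Rmin (u + r) 1)) - F u - (A u * G (y u) - F u))
  with (A u * (G (y (Rmin (u + r) 1)) - G (y u))) by ring.
rewrite Rabs_mult.
apply Rle_trans with (K * (e / (K + 1))).
- apply Rmult_le_compat; auto; try apply Rabs_pos; apply BA; lra.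
- assert (0 <= e / (K + 1)) by (left; apply Rdiv_lt_0_compat; lra).
  replace e with ((K + 1) * (e / (K + 1))) at 2 by (field; lra); lra.
Qed.

(** The Cauchy property behind existence: monotonicity of [G] absorbs the
    difference of the two solutions and leaves only the two defects. *)
Lemma approximate_solutions_close (A F G : R -> R) (e e' : R) (y z : R -> R) :
  (forall u, 0 < u < 1 -> 0 <= A u) ->
  (forall x y, x <= y -> G x <= G y) -> 0 <= e -> 0 <= e' ->
  approximate_solution A F G e y -> approximate_solution A F G e' z ->
  forall u, 0 <= u <= 1 -> Rabs (y u - z u) <= e + e'.
Proof.
intros PA MG He He' [Cy [y1 [y' Dy]]] [Cz [z1 [z' Dz]]] u Hu.
apply Rle_trans with ((e + e') * (1 - u)); [|nra].
assert (HAG : forall t x x', 0 < t < 1 -> x < x' -> A t * G x <= A t * G x').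
{ intros t x x' Ht Hx; apply Rmult_le_compat_l; auto; apply MG; lra. }
apply (backward_stability y z y' z' 0 1); auto.
- lra.
- intros t Ht; now apply Dy.
- intros t Ht; now apply Dz.
- congruence.
- intros t Ht Hlt; specialize (HAG t _ _ Ht Hlt).
  destruct (Dy t Ht) as [_ By]; destruct (Dz t Ht) as [_ Bz].
  apply Rabs_le_between in By; apply Rabs_le_between in Bz; lra.
- intros t Ht Hlt; specialize (HAG t _ _ Ht Hlt).
  destruct (Dy t Ht) as [_ By]; destruct (Dz t Ht) as [_ Bz].
  apply Rabs_le_between in By; apply Rabs_le_between in Bz; lra.
Qed.

Lemma approximate_solution_lipschitz (A F G : R -> R) (K M B e : R) (y : R -> R) :
  (forall u, 0 <= u <= 1 -> Rabs (A u) <= K) ->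
  (forall u, 0 <= u <= 1 -> Rabs (F u) <= M) ->
  (forall x, Rabs (G x) <= B) -> 0 <= e ->
  approximate_solution A F G e y ->
  forall u v, 0 <= u <= 1 -> 0 <= v <= 1 ->
  Rabs (y u - y v) <= (K * B + M + e) * Rabs (u - v).
Proof.
intros BA BF BG He [Cy [_ [y' Dy]]].
assert (HKB : forall t, 0 <= t <= 1 -> Rabs (A t * G (y t)) <= K * B).
{ intros t Ht; rewrite Rabs_mult.
  apply Rmult_le_compat; auto; apply Rabs_pos. }
apply lipschitz_of_derive_bound with (y' := y'); auto.
- generalize (Rabs_pos (A 0 * G (y 0))) (HKB 0 ltac:(lra)).
  generalize (Rabs_pos (F 0)) (BF 0 ltac:(lra)); lra.
- intros t Ht; now apply Dy.
- intros t Ht; destruct (Dy t Ht) as [_ By].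
  specialize (HKB t ltac:(lra)); specialize (BF t ltac:(lra)).
  apply Rabs_le_between in By; apply Rabs_le_between in HKB.
  apply Rabs_le_between in BF; apply Rabs_le; lra.
Qed.

(** The approximate solutions converge uniformly to a Lipschitz function.  It
    satisfies the integral equation because the right side [Z] of the latter,
    formed with the limit, is compared by [backward_stability] with the
    approximate solutions, whose derivatives are uniformly close to that
    of [Z]. *)
Lemma backward_solution_exists (A F G : R -> R) (B : R) :
  (forall u, continuous A u) -> (forall u, continuous F u) ->
  (forall u, 0 < u < 1 -> 0 <= A u) ->
  unif_continuous G -> (forall x, Rabs (G x) <= B) ->
  (forall x y, x <= y -> G x <= G y) ->
  exists y : R -> R, (forall u, continuous y u) /\ y 1 = 0 /\
    forall u, 0 < u < 1 -> is_derive y u (A u * G (y u) - F u).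
Proof.
intros CA CF PA UG BG MG.
destruct (bounded_on_segment A 0 1) as [K [HK BA]]; [lra|auto|].
destruct (bounded_on_segment F 0 1) as [M [HM BF]]; [lra|auto|].
assert (HB : 0 <= B) by (generalize (BG 0), (Rabs_pos (G 0)); lra).
assert (HKB : 0 <= K * B) by now apply Rmult_le_pos.
set (tol := fun n => / (INR n + 1)).
assert (Htol : forall n, 0 < tol n).
{ intros n; apply Rinv_0_lt_compat; generalize (pos_INR n); lra. }
assert (Htol_le : forall n m, (n <= m)%nat -> tol m <= tol n).
{ intros n m Hnm; apply Rinv_le_contravar.
  - generalize (pos_INR n); lra.
  - apply le_INR in Hnm; lra. }
assert (Htol0 : forall e, 0 < e -> exists n, tol n < e).
{ intros e He; destruct (nfloor_ex (/ e)) as [n [_ Hn]].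
  - left; now apply Rinv_0_lt_compat.
  - exists n; rewrite <- (Rinv_inv e); apply Rinv_lt_contravar; auto.
    apply Rmult_lt_0_compat; [now apply Rinv_0_lt_compat|].
    generalize (pos_INR n); lra. }
pose (T := fun n =>
  approximate_solution_exists A F G B (tol n) CA CF UG BG (Htol n)).
set (Y := fun n => proj1_sig (constructive_indefinite_description _ (T n))).
assert (HY : forall n, approximate_solution A F G (tol n) (Y n)).
{ intros n; exact (proj2_sig (constructive_indefinite_description _ (T n))). }
clearbody Y; clear T.
assert (Hcauchy : forall n m u, (n <= m)%nat -> 0 <= u <= 1 ->
                  Rabs (Y n u - Y m u) <= 2 * tol n).
{ intros n m u Hnm Hu.
  generalize (approximate_solutions_close A F G (tol n) (tol m) (Y n) (Y m) PA MG
                (Rlt_le _ _ (Htol n)) (Rlt_le _ _ (Htol m)) (HY n) (HY m) u Hu).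
  specialize (Htol_le n m Hnm); lra. }
assert (Hlip : forall n u v, 0 <= u <= 1 -> 0 <= v <= 1 ->
    Rabs (Y n u - Y n v) <= (K * B + M + 1) * Rabs (u - v)).
{ intros n u v Hu Hv.
  apply Rle_trans with ((K * B + M + tol n) * Rabs (u - v)).
  - apply (approximate_solution_lipschitz A F G K M B (tol n)); auto.
    left; apply Htol.
  - apply Rmult_le_compat_r; [apply Rabs_pos|].
    assert (tol n <= 1); [|lra].
    generalize (Htol_le 0%nat n (Nat.le_0_l n)).
    unfold tol at 2; simpl; rewrite Rplus_0_l, Rinv_1; auto. }
set (y := fun u => real (Lim_seq (fun n => Y n u))).
assert (Hlim : forall u, 0 <= u <= 1 -> is_lim_seq (fun n => Y n u) (y u)).
{ intros u Hu; apply Lim_seq_correct', ex_lim_seq_cauchy_corr; intros e.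
  destruct (Htol0 (e / 4)) as [N HN]; [destruct e; simpl; lra|].
  exists N; intros n m Hn Hm.
  generalize (Hcauchy N n u Hn Hu) (Hcauchy N m u Hm Hu); intros H1 H2.
  rewrite Rabs_minus_sym in H1.
  replace (Y n u - Y m u) with ((Y n u - Y N u) + (Y N u - Y m u)) by ring.
  apply Rle_lt_trans with (1 := Rabs_triang _ _); lra. }
assert (Hunif : forall n u, 0 <= u <= 1 -> Rabs (Y n u - y u) <= 2 * tol n).
{ intros n u Hu; apply Rle_plus_epsilon; intros e He.
  generalize (proj2 (is_lim_seq_spec _ _) (Hlim u Hu)); intros Hl.
  destruct (Hl (mkposreal e He)) as [N HN]; simpl in HN.
  specialize (HN (Nat.max n N) (Nat.le_max_r _ _)).
  generalize (Hcauchy n (Nat.max n N) u (Nat.le_max_l _ _) Hu); intros H.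
  replace (Y n u - y u)
    with ((Y n u - Y (Nat.max n N) u) + (Y (Nat.max n N) u - y u)) by ring.
  apply Rle_trans with (1 := Rabs_triang _ _); lra. }
set (yc := fun u => y (clamp 0 1 u)).
assert (Cyc : forall u, continuous yc u).
{ apply lipschitz_continuous with (K * B + M + 1); intros u v; unfold yc.
  apply Rle_trans with ((K * B + M + 1) * Rabs (clamp 0 1 u - clamp 0 1 v)).
  2: apply Rmult_le_compat_l; [lra|apply clamp_lip].
  assert (Hu : 0 <= clamp 0 1 u <= 1) by (apply clamp_in; lra).
  assert (Hv : 0 <= clamp 0 1 v <= 1) by (apply clamp_in; lra).
  apply Rle_plus_epsilon; intros e He; destruct (Htol0 (e / 4)) as [n Hn]; [lra|].
  generalize (Hunif n _ Hu) (Hunif n _ Hv) (Hlip n _ _ Hu Hv).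
  set (s := clamp 0 1 u) in *; set (t := clamp 0 1 v) in *; intros H1 H2 H3.
  replace (y s - y t) with ((y s - Y n s) + (Y n s - Y n t) + (Y n t - y t)) by ring.
  rewrite Rabs_minus_sym in H1.
  apply Rle_trans with (1 := Rabs_triang _ _).
  apply Rle_trans with (Rabs (y s - Y n s) + Rabs (Y n s - Y n t) + Rabs (Y n t - y t)).
  - apply Rplus_le_compat_r, Rabs_triang.
  - lra. }
assert (CI : forall s, continuous (fun s => F s - A s * G (yc s)) s).
{ intros s; apply (continuous_minus F (fun s => A s * G (yc s))); auto.
  apply (continuous_mult A (fun s => G (yc s))); auto.
  apply (continuous_comp yc G); auto; now apply unif_continuous_continuous. }
(* [Z] is the right side of the integral equation for the limit *)
set (Z := fun u => RInt (fun s => F s - A s * G (yc s)) u 1).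
assert (DZ : forall u, is_derive Z u (A u * G (yc u) - F u)).
{ intros u; replace (A u * G (yc u) - F u) with (- (F u - A u * G (yc u))) by ring.
  apply (is_derive_RInt_lower (fun s => F s - A s * G (yc s))); auto. }
assert (HZ : forall u, 0 <= u <= 1 -> yc u = Z u).
{ intros u Hu; unfold yc; rewrite clamp_id by auto.
  apply Rminus_diag_uniq; apply Rabs_eq_0; apply Rle_antisym; [|apply Rabs_pos].
  apply Rle_plus_epsilon; intros e He.
  destruct (UG (e / (2 * (K + 1)))) as [d [Hd HG]]; [apply Rdiv_lt_0_compat; lra|].
  destruct (Htol0 (Rmin (d / 2) (e / 6))) as [n Hn]; [apply Rmin_glb_lt; lra|].
  assert (Hn1 := Rlt_le_trans _ _ _ Hn (Rmin_l _ _)).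
  assert (Hn2 := Rlt_le_trans _ _ _ Hn (Rmin_r _ _)).
  destruct (HY n) as [Cn [n1 [p Dn]]].
  assert (Hk : 0 <= e / (2 * (K + 1))) by (left; apply Rdiv_lt_0_compat; lra).
  assert (Hke : K * (e / (2 * (K + 1))) <= e / 2).
  { replace (e / 2) with ((K + 1) * (e / (2 * (K + 1)))) by (field; lra); lra. }
  assert (0 <= K * (e / (2 * (K + 1)))) by (apply Rmult_le_pos; auto).
  assert (Hcl : forall t, 0 < t < 1 ->
     Rabs (A t * G (Y n t) - A t * G (yc t)) <= e / 2).
  { intros t Ht; apply Rle_trans with (2 := Hke).
    rewrite <- Rmult_minus_distr_l, Rabs_mult.
    apply Rmult_le_compat; try apply Rabs_pos; [apply BA; lra|].
    apply HG; unfold yc; rewrite clamp_id by lra.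
    apply Rle_lt_trans with (1 := Hunif n t ltac:(lra)); lra. }
  assert (H1 : Rabs (Y n u - Z u) <= (e / 2 + tol n) * (1 - u)).
  { generalize (Htol n); intros Hn0.
    apply (backward_stability (Y n) Z p (fun u => A u * G (yc u) - F u) 0 1); auto.
    - lra.
    - intros t _; apply @ex_derive_continuous; eexists; apply DZ.
    - intros t Ht; now apply Dn.
    - rewrite n1; symmetry; apply @RInt_point.
    - intros t Ht _; destruct (Dn t Ht) as [_ Bn]; specialize (Hcl t Ht).
      apply Rabs_le_between in Bn; apply Rabs_le_between in Hcl; lra.
    - intros t Ht _; destruct (Dn t Ht) as [_ Bn]; specialize (Hcl t Ht).
      apply Rabs_le_between in Bn; apply Rabs_le_between in Hcl; lra. }
  generalize (Hunif n u Hu) (Htol n); intros H2 H3.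
  rewrite Rabs_minus_sym in H2.
  replace (y u - Z u) with ((y u - Y n u) + (Y n u - Z u)) by ring.
  apply Rle_trans with (1 := Rabs_triang _ _); nra. }
exists Z; split; [|split].
- intros u; apply @ex_derive_continuous; eexists; apply DZ.
- apply @RInt_point.
- intros u Hu; rewrite <- HZ by lra; apply DZ.
Qed.

(** * The equation in terms of versine, sine and tangent *)

(** If [y] is the versine [1 - cos t], this is [tan t]. *)
Definition tan_of_versin (y : R) : R := sqrt (y * (2 - y)) / (1 - y).

(** For [0 <= s <= 1], the versine of the angle in [[0, PI/2]] with sine [s]. *)
Definition versin_of_sin (s : R) : R := 1 - sqrt (1 - s ^ 2).

Lemma tan_of_versin_nonneg x : x < 1 -> 0 <= tan_of_versin x.
Proof.
intros Hx; apply Rmult_le_pos; [apply sqrt_pos|].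
left; apply Rinv_0_lt_compat; lra.
Qed.

Lemma tan_of_versin_le x y :
  0 <= x -> x <= y -> y < 1 -> tan_of_versin x <= tan_of_versin y.
Proof.
intros Hx Hxy Hy; apply Rmult_le_compat.
- apply sqrt_pos.
- left; apply Rinv_0_lt_compat; lra.
- apply sqrt_le_1_alt; nra.
- apply Rinv_le_contravar; lra.
Qed.

Lemma tan_of_versin_0 : tan_of_versin 0 = 0.
Proof. unfold tan_of_versin; rewrite Rmult_0_l, sqrt_0; unfold Rdiv; ring. Qed.

Lemma tan_of_versin_continuous (x : R) : x < 1 -> continuous tan_of_versin x.
Proof.
intros Hx; unfold tan_of_versin.
apply (continuous_mult (fun y => sqrt (y * (2 - y))) (fun y => / (1 - y))).
- apply (continuous_comp (fun y => y * (2 - y)) sqrt).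
  + apply @ex_derive_continuous; auto_derive; auto.
  + apply continuous_sqrt.
- apply @ex_derive_continuous; auto_derive; lra.
Qed.

Lemma tan_of_versin_lower_bound d : 0 < d < 1 -> / d - 1 <= tan_of_versin (1 - d).
Proof.
intros Hd; unfold tan_of_versin; replace (1 - (1 - d)) with d by ring.
replace (/ d - 1) with ((1 - d) / d) by (field; lra).
apply Rmult_le_compat_r; [left; apply Rinv_0_lt_compat; lra|].
rewrite <- (sqrt_square (1 - d)) at 1 by lra.
apply sqrt_le_1_alt; nra.
Qed.

Lemma versin_of_sin_le s t : 0 <= s -> s <= t -> versin_of_sin s <= versin_of_sin t.
Proof.
intros Hs Hst; unfold versin_of_sin.
generalize (sqrt_le_1_alt (1 - t ^ 2) (1 - s ^ 2)); nra.
Qed.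

Lemma versin_of_sin_lt s t :
  0 <= s -> s < t -> t <= 1 -> versin_of_sin s < versin_of_sin t.
Proof.
intros Hs Hst Ht; unfold versin_of_sin.
assert (sqrt (1 - t ^ 2) < sqrt (1 - s ^ 2)) by (apply sqrt_lt_1_alt; nra); lra.
Qed.

Lemma versin_of_sin_0 : versin_of_sin 0 = 0.
Proof.
unfold versin_of_sin; replace (1 - 0 ^ 2) with 1 by ring; rewrite sqrt_1; ring.
Qed.

Lemma versin_of_sin_sqrt v : 0 <= v <= 1 -> versin_of_sin (sqrt (v * (2 - v))) = v.
Proof.
intros Hv; unfold versin_of_sin; rewrite pow2_sqrt by nra.
replace (1 - v * (2 - v)) with ((1 - v) * (1 - v)) by ring.
rewrite sqrt_square; lra.
Qed.

Lemma versin_of_sin_continuous (s : R) : continuous versin_of_sin s.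
Proof.
apply (continuous_minus (fun _ => 1) (fun s => sqrt (1 - s ^ 2))).
- apply continuous_const.
- apply (continuous_comp (fun s => 1 - s ^ 2) sqrt).
  + apply @ex_derive_continuous; auto_derive; auto.
  + apply continuous_sqrt.
Qed.

(** This is the separation of variables that solves the equation where [f]
    vanishes: if the sine has derivative [k'], the versine has derivative
    [k'] times the tangent. *)
Lemma is_derive_versin_of_sin_comp (k : R -> R) (u k' : R) :
  is_derive k u k' -> 0 <= k u < 1 ->
  is_derive (fun t => versin_of_sin (k t)) u (k' * tan_of_versin (versin_of_sin (k u))).
Proof.
intros Dk Hk; apply (is_derive_comp versin_of_sin k); auto.
assert (Hpos : 0 < 1 - k u ^ 2) by nra.
assert (Hs : 0 < sqrt (1 - k u ^ 2)) by now apply sqrt_lt_R0.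
replace (tan_of_versin (versin_of_sin (k u))) with (k u / sqrt (1 - k u ^ 2)).
- unfold versin_of_sin; auto_derive; [simpl in *; lra|].
  replace (1 + - (k u * (k u * 1))) with (1 - k u ^ 2) by ring; field; lra.
- unfold tan_of_versin, versin_of_sin; rewrite (Rmult_comm (1 - _)).
  replace ((2 - (1 - sqrt (1 - k u ^ 2))) * (1 - sqrt (1 - k u ^ 2)))
    with (1 - sqrt (1 - k u ^ 2) ^ 2) by ring.
  rewrite pow2_sqrt by lra; replace (1 - (1 - k u ^ 2)) with (k u * k u) by ring.
  rewrite sqrt_square by lra; f_equal; ring.
Qed.

(** Clamping at [1 - d] removes the pole of the tangent; clamping at [0] keeps
    the nonlinearity defined and monotone below [0]. *)
Definition trunc_tan (d y : R) : R := tan_of_versin (clamp 0 (1 - d) y).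

Lemma trunc_tan_unif_continuous d : 0 < d < 1 -> unif_continuous (trunc_tan d).
Proof.
intros Hd e He.
destruct (Heine_cor2 (f := tan_of_versin) (a := 0) (b := 1 - d)) with (mkposreal e He)
  as [del Hdel].
- intros x Hx; apply continuity_pt_filterlim, tan_of_versin_continuous; lra.
- exists del; split; [apply cond_pos|]; intros x y Hxy; left.
  apply Hdel; try (apply clamp_in; lra).
  apply Rle_lt_trans with (2 := Hxy), clamp_lip.
Qed.

Lemma trunc_tan_nonneg d y : 0 < d < 1 -> 0 <= trunc_tan d y.
Proof.
intros Hd; apply tan_of_versin_nonneg; generalize (clamp_in 0 (1 - d) y); lra.
Qed.

Lemma trunc_tan_bounded d y : 0 < d < 1 -> Rabs (trunc_tan d y) <= tan_of_versin (1 - d).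
Proof.
intros Hd; rewrite Rabs_right by (apply Rle_ge, trunc_tan_nonneg; auto).
generalize (clamp_in 0 (1 - d) y); intros H; apply tan_of_versin_le; lra.
Qed.

Lemma trunc_tan_le d x y : 0 < d < 1 -> x <= y -> trunc_tan d x <= trunc_tan d y.
Proof.
intros Hd Hxy; generalize (clamp_in 0 (1 - d) x) (clamp_in 0 (1 - d) y).
intros; apply tan_of_versin_le; try lra; now apply clamp_le.
Qed.

Lemma trunc_tan_id d y : 0 <= y <= 1 - d -> trunc_tan d y = tan_of_versin y.
Proof. intros Hy; unfold trunc_tan; now rewrite clamp_id. Qed.

Lemma trunc_tan_nonpos d y : 0 < d < 1 -> y <= 0 -> trunc_tan d y = 0.
Proof.
intros Hd Hy; rewrite <- tan_of_versin_0; unfold trunc_tan, clamp; f_equal.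
unfold Rmax, Rmin; repeat destruct Rle_dec; lra.
Qed.

Lemma trunc_tan_above d y :
  0 < d < 1 -> 1 - d <= y -> trunc_tan d y = tan_of_versin (1 - d).
Proof.
intros Hd Hy; unfold trunc_tan, clamp; f_equal.
unfold Rmax, Rmin; repeat destruct Rle_dec; lra.
Qed.

(** * Backward solutions of the truncated equation *)

Definition truncated_solution (d : R) (A F y : R -> R) : Prop :=
  (forall u, continuous y u) /\ y 1 = 0 /\
  forall u, 0 < u < 1 -> is_derive y u (A u * trunc_tan d (y u) - F u).

Lemma truncated_solution_exists (d : R) (A F : R -> R) :
  0 < d < 1 -> (forall u, continuous A u) -> (forall u, continuous F u) ->
  (forall u, 0 < u < 1 -> 0 <= A u) -> exists y, truncated_solution d A F y.
Proof.
intros Hd CA CF PA.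
apply (backward_solution_exists A F (trunc_tan d) (tan_of_versin (1 - d))); auto.
- now apply trunc_tan_unif_continuous.
- intros; now apply trunc_tan_bounded.
- intros; now apply trunc_tan_le.
Qed.

(** Two speeds change the right side by at most the bound of the truncated
    tangent times their difference. *)
Lemma truncated_solution_lipschitz_speed (d c c' : R) (a F y y' : R -> R) :
  0 < d < 1 -> (forall u, 0 < u < 1 -> 0 <= c + a u) ->
  (forall u, 0 < u < 1 -> 0 <= c' + a u) ->
  truncated_solution d (fun u => c + a u) F y ->
  truncated_solution d (fun u => c' + a u) F y' ->
  forall u, 0 <= u <= 1 -> Rabs (y u - y' u) <= tan_of_versin (1 - d) * Rabs (c - c').
Proof.
intros Hd Pc Pc' [Cy [y1 Dy]] [Cy' [y'1 Dy']] u Hu.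
assert (Hg : 0 <= tan_of_versin (1 - d)) by (apply tan_of_versin_nonneg; lra).
assert (Hcc := Rabs_pos (c - c')).
assert (He : 0 <= tan_of_versin (1 - d) * Rabs (c - c')) by now apply Rmult_le_pos.
assert (Hdiff : forall x,
  Rabs ((c - c') * trunc_tan d x) <= tan_of_versin (1 - d) * Rabs (c - c')).
{ intros x; rewrite Rabs_mult, Rmult_comm.
  apply Rmult_le_compat_r; auto; now apply trunc_tan_bounded. }
apply Rle_trans with (tan_of_versin (1 - d) * Rabs (c - c') * (1 - u)); [|nra].
apply (backward_stability _ _ _ _ 0 1 _ He) with (3 := Dy) (4 := Dy'); auto.
- congruence.
- intros t Ht Hlt; generalize (trunc_tan_le d (y' t) (y t) Hd ltac:(lra)); intros HG.
  apply Rmult_le_compat_l with (r := c + a t) in HG; auto.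
  specialize (Hdiff (y' t)); apply Rabs_le_between in Hdiff; lra.
- intros t Ht Hlt; generalize (trunc_tan_le d (y t) (y' t) Hd ltac:(lra)); intros HG.
  apply Rmult_le_compat_l with (r := c + a t) in HG; auto.
  specialize (Hdiff (y' t)); apply Rabs_le_between in Hdiff; lra.
Qed.

Lemma truncated_solution_nonneg (d : R) (A F y : R -> R) :
  0 < d < 1 -> (forall u, 0 < u < 1 -> 0 <= F u) ->
  truncated_solution d A F y -> forall u, 0 <= u <= 1 -> 0 <= y u.
Proof.
intros Hd PF [Cy [y1 Dy]] u Hu.
enough (0 <= y u + 0 * (1 - u)) by lra.
apply (backward_comparison (fun _ => 0) y (fun _ => 0)) with (5 := Dy); auto; try lra.
- intros; apply continuous_const.
- intros; apply @is_derive_const.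
- intros t Ht Hlt; rewrite trunc_tan_nonpos by lra.
  generalize (PF t Ht); lra.
Qed.

(** An interior zero would be a minimum of the nonnegative function [y], with
    derivative [0]; but the equation gives it the derivative [- F u < 0]. *)
Lemma truncated_solution_pos (d : R) (A F y : R -> R) (u : R) :
  0 < d < 1 -> (forall u, 0 < u < 1 -> 0 <= F u) ->
  truncated_solution d A F y -> 0 < u < 1 -> 0 < F u -> 0 < y u.
Proof.
intros Hd PF Hy Hu HF.
generalize (truncated_solution_nonneg d A F y Hd PF Hy); intros Hpos.
destruct (Rle_lt_or_eq_dec 0 (y u)) as [H|H]; [apply Hpos; lra|auto|].
destruct Hy as [_ [_ Dy]]; specialize (Dy u Hu).
apply is_derive_Reals in Dy.
assert (H0 := deriv_minimum y 0 1 u (exist _ _ Dy) (proj1 Hu) (proj2 Hu)).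
simpl in H0; rewrite <- H, trunc_tan_nonpos in H0 by lra.
enough (A u * 0 - F u = 0) by lra.
apply H0; intros x H1 H2; apply Hpos; lra.
Qed.

(** Dropping the nonnegative tangent term leaves [y' = - F]. *)
Lemma truncated_solution_le_tail (d : R) (A F y : R -> R) :
  0 < d < 1 -> (forall u, continuous F u) -> (forall u, 0 < u < 1 -> 0 <= A u) ->
  truncated_solution d A F y -> forall u, 0 <= u <= 1 -> y u <= RInt F u 1.
Proof.
intros Hd CF PA [Cy [y1 Dy]] u Hu.
enough (y u <= RInt F u 1 + 0 * (1 - u)) by lra.
apply (backward_comparison y (fun u => RInt F u 1)
         _ (fun u => - F u) 0 1 0) with (4 := Dy); auto; try lra.
- intros t _; apply @ex_derive_continuous; eexists.
  now apply is_derive_RInt_lower.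
- intros; now apply is_derive_RInt_lower.
- rewrite y1; right; symmetry; apply @RInt_point.
- intros t Ht _; generalize (trunc_tan_nonneg d (y t) Hd) (PA t Ht); nra.
Qed.
(** Since [y] is at most [P = RInt F xi 1] on [[xi, 1]], the tangent term costs
    at most the tangent at [P] times the total increase of [h]. *)
Lemma truncated_solution_ge_tail (d : R) (A F h y : R -> R) (xi : R) :
  0 < d < 1 -> (forall u, continuous F u) -> (forall u, continuous h u) ->
  (forall u, 0 < u < 1 -> 0 <= F u) ->
  (forall u, 0 < u < 1 -> 0 <= A u) ->
  (forall u, 0 < u < 1 -> is_derive h u (A u)) ->
  truncated_solution d A F y -> 0 <= xi <= 1 -> RInt F xi 1 <= 1 - d ->
  RInt F xi 1 - (h 1 - h xi) * tan_of_versin (RInt F xi 1) <= y xi.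
Proof.
intros Hd CF Ch PF PA Dh Hy Hxi HP.
generalize (truncated_solution_le_tail d A F y Hd CF PA Hy); intros Hle.
assert (Hy0 : 0 <= y xi) by (apply (truncated_solution_nonneg d A F y); auto).
set (P := RInt F xi 1) in *.
set (z := fun u => RInt F u 1 + tan_of_versin P * (h u - h 1)).
assert (Htail : forall u, xi <= u <= 1 -> RInt F u 1 <= P).
{ intros u Hu; apply RInt_tail_le; auto; lra. }
assert (HP0 : 0 <= P) by (generalize (Hle xi Hxi); unfold P; lra).
destruct Hy as [Cy [y1 Dy]].
assert (Dz : forall u, 0 < u < 1 -> is_derive z u (tan_of_versin P * A u - F u)).
{ intros u Hu; unfold z.
  replace (tan_of_versin P * A u - F u) with (plus (- F u) (tan_of_versin P * (A u - 0)))
    by (unfold plus; simpl; ring).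
  apply @is_derive_plus; [now apply is_derive_RInt_lower|].
  apply is_derive_scal; apply @is_derive_minus; auto.
  apply @is_derive_const. }
enough (z xi <= y xi + 0 * (1 - xi)) by (unfold z in *; fold P in H; lra).
apply (backward_comparison z y (fun u => tan_of_versin P * A u - F u)
         (fun u => A u * trunc_tan d (y u) - F u) xi 1 0); auto; try lra.
- intros u _; unfold z.
  apply (continuous_plus (fun u => RInt F u 1) (fun u => tan_of_versin P * (h u - h 1))).
  + apply @ex_derive_continuous; eexists; now apply is_derive_RInt_lower.
  + apply (continuous_mult (fun _ => tan_of_versin P)); [apply continuous_const|].
    apply (continuous_minus h); auto; apply continuous_const.
- intros; apply Dz; lra.
- intros; apply Dy; lra.
- unfold z; rewrite y1, RInt_point; unfold zero; simpl; lra.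
- intros u Hu _.
  assert (HG : trunc_tan d (y u) <= tan_of_versin P).
  { rewrite <- (trunc_tan_id d P) by lra; apply trunc_tan_le; auto.
    apply Rle_trans with (RInt F u 1); [apply Hle|apply Htail]; lra. }
  apply Rmult_le_compat_l with (r := A u) in HG; [lra|apply PA; lra].
Qed.

(** To the right of [xi] there is not enough mass of [F] left to reach the
    cut-off level [1 - d].  To its left, the hypothesis on [m] and [M] says that
    at that level the tangent term overcomes [F], so that [y] cannot cross it
    backward. *)
Lemma truncated_solution_le_cap (d m M : R) (A F y : R -> R) (a xi : R) :
  0 < d < 1 -> 0 <= a -> xi <= 1 -> (forall u, continuous F u) ->
  (forall u, 0 < u < 1 -> 0 <= F u) -> (forall u, 0 < u < 1 -> 0 <= A u) ->
  (forall u, a < u < xi -> m <= A u) -> (forall u, a < u < xi -> F u <= M) ->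
  M <= m * tan_of_versin (1 - d) -> 0 <= xi -> RInt F xi 1 <= 1 - d ->
  truncated_solution d A F y -> forall u, a <= u <= 1 -> y u <= 1 - d.
Proof.
intros Hd Ha Hxi CF PF PA HA HF HM Hxi0 HP Hy.
assert (Htail : forall u, xi <= u <= 1 -> y u <= 1 - d).
{ intros u Hu; apply Rle_trans with (RInt F u 1).
  - apply (truncated_solution_le_tail d A F y); auto; lra.
  - apply Rle_trans with (RInt F xi 1); auto; apply RInt_tail_le; auto; lra. }
intros u Hu; destruct (Rle_dec xi u) as [H|H]; [apply Htail; lra|].
destruct Hy as [Cy [y1 Dy]].
enough (y u <= 1 - d + 0 * (xi - u)) by lra.
apply (backward_comparison y (fun _ => 1 - d)
         (fun u => A u * trunc_tan d (y u) - F u) (fun _ => 0) a xi 0);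
  auto; try lra.
- intros; apply continuous_const.
- intros; apply Dy; lra.
- intros; apply @is_derive_const.
- apply Htail; lra.
- intros t Ht Hlt; rewrite trunc_tan_above by lra.
  generalize (tan_of_versin_nonneg (1 - d) ltac:(lra)) (HA t Ht) (HF t Ht); nra.
Qed.

(** Since [F >= 0], the sine of a solution increases at most at the rate [A];
    so, run backward from [b], it stays above any [k] with [k' = A]. *)
Lemma versin_of_sin_le_truncated_solution (d : R) (A F k y : R -> R) (a b : R) :
  0 < d < 1 -> 0 <= a -> b <= 1 ->
  (forall u, 0 < u < 1 -> 0 <= F u) -> (forall u, 0 < u < 1 -> 0 <= A u) ->
  (forall u, continuous k u) -> (forall u, 0 < u < 1 -> is_derive k u (A u)) ->
  (forall u, a <= u <= b -> 0 <= k u < 1 /\ versin_of_sin (k u) <= 1 - d) ->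
  truncated_solution d A F y -> versin_of_sin (k b) <= y b ->
  forall u, a <= u <= b -> versin_of_sin (k u) <= y u.
Proof.
intros Hd Ha Hb PF PA Ck Dk Hk [Cy [y1 Dy]] Hyb u Hu.
enough (versin_of_sin (k u) <= y u + 0 * (b - u)) by lra.
apply (backward_comparison (fun u => versin_of_sin (k u)) y
         (fun u => A u * tan_of_versin (versin_of_sin (k u)))
         (fun u => A u * trunc_tan d (y u) - F u) a b 0); auto; try lra.
- intros; apply (continuous_comp k versin_of_sin); auto; apply versin_of_sin_continuous.
- intros t Ht; apply is_derive_versin_of_sin_comp; [apply Dk|apply Hk]; lra.
- intros; apply Dy; lra.
- intros t Ht Hlt; destruct (Hk t ltac:(lra)) as [Hk1 Hk2].
  rewrite <- (trunc_tan_id d (versin_of_sin (k t))).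
  + generalize (trunc_tan_le d (y t) (versin_of_sin (k t)) Hd ltac:(lra)); intros HG.
    apply Rmult_le_compat_l with (r := A t) in HG; [|apply PA; lra].
    specialize (PF t ltac:(lra)); lra.
  + split; auto; rewrite <- versin_of_sin_0; apply versin_of_sin_le; lra.
Qed.

(** Where [F] vanishes, backward uniqueness identifies the solution with the
    explicit one obtained by separation of variables. *)
Lemma truncated_solution_eq_versin_of_sin (d : R) (A F k y : R -> R) (a b : R) :
  0 < d < 1 -> 0 <= a -> b <= 1 ->
  (forall u, 0 < u < 1 -> 0 <= A u) -> (forall u, a < u < b -> F u = 0) ->
  (forall u, continuous k u) -> (forall u, 0 < u < 1 -> is_derive k u (A u)) ->
  (forall u, a <= u <= b -> 0 <= k u < 1 /\ versin_of_sin (k u) <= 1 - d) ->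
  truncated_solution d A F y -> y b = versin_of_sin (k b) ->
  forall u, a <= u <= b -> y u = versin_of_sin (k u).
Proof.
intros Hd Ha Hb PA F0 Ck Dk Hk [Cy [y1 Dy]] Hyb u Hu.
assert (Hpsi : forall t, a < t < b ->
  trunc_tan d (versin_of_sin (k t)) = tan_of_versin (versin_of_sin (k t))).
{ intros t Ht; destruct (Hk t ltac:(lra)) as [Hk1 Hk2].
  apply trunc_tan_id; split; auto.
  rewrite <- versin_of_sin_0; apply versin_of_sin_le; lra. }
apply Rminus_diag_uniq, Rabs_eq_0, Rle_antisym; [|apply Rabs_pos].
replace 0 with (0 * (b - u)) by ring.
apply (backward_stability y (fun u => versin_of_sin (k u))
         (fun u => A u * trunc_tan d (y u) - F u)
         (fun u => A u * tan_of_versin (versin_of_sin (k u))) a b 0); auto; try lra.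
- intros; apply (continuous_comp k versin_of_sin); auto; apply versin_of_sin_continuous.
- intros; apply Dy; lra.
- intros t Ht; apply is_derive_versin_of_sin_comp; [apply Dk|apply Hk]; lra.
- intros t Ht Hlt; rewrite F0, <- Hpsi by auto.
  generalize (trunc_tan_le d (versin_of_sin (k t)) (y t) Hd ltac:(lra)); intros HG.
  apply Rmult_le_compat_l with (r := A t) in HG; [lra|apply PA; lra].
- intros t Ht Hlt; rewrite F0, <- Hpsi by auto.
  generalize (trunc_tan_le d (y t) (versin_of_sin (k t)) Hd ltac:(lra)); intros HG.
  apply Rmult_le_compat_l with (r := A t) in HG; [lra|apply PA; lra].
Qed.

(** * Shooting for the speed *)

(** The bound [v <= y xi] is propagated to [u0] along sines.  The surplus [e] is
    the room left between [h xi] and the sine at versine [v]; it is what makes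
    the comparison at zero speed strict, hence the speed found positive. *)
Lemma zero_speed_lower_bound (d : R) (a f h y : R -> R) (u0 xi v e : R) :
  0 < d < 1 -> 0 <= u0 -> u0 <= xi -> xi <= 1 ->
  (forall u, continuous f u) -> (forall u, continuous h u) ->
  (forall u, 0 < u < 1 -> is_derive h u (a u)) ->
  (forall u, 0 < u < 1 -> 0 <= a u) -> (forall u, 0 < u < 1 -> 0 <= f u) ->
  truncated_solution d a f y ->
  RInt f xi 1 <= 1 - d -> 0 <= v <= 1 - d ->
  v <= RInt f xi 1 - (h 1 - h xi) * tan_of_versin (RInt f xi 1) ->
  0 <= h u0 + e -> h xi + e = sqrt (v * (2 - v)) ->
  versin_of_sin (h u0 + e) <= y u0.
Proof.
intros Hd Hu0 Hxi Hxi1 Cf Ch Dh Pa Pf Hy HP Hv HvP He0 He.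
assert (Mh := nondecreasing_of_derive_nonneg h a Ch Dh Pa).
assert (Hpsi : versin_of_sin (sqrt (v * (2 - v))) = v) by (apply versin_of_sin_sqrt; lra).
assert (Hlt : sqrt (v * (2 - v)) < 1).
{ rewrite <- sqrt_1; apply sqrt_lt_1_alt; nra. }
apply (versin_of_sin_le_truncated_solution d a f (fun u => h u + e) y u0 xi);
  auto; try lra.
- intros u; apply (continuous_plus h (fun _ => e)); auto.
  apply continuous_const.
- intros u Hu; rewrite <- (Rplus_0_r (a u)); apply @is_derive_plus; auto.
  apply @is_derive_const.
- intros u Hu.
  assert (h u0 <= h u) by (apply Mh; lra).
  assert (h u <= h xi) by (apply Mh; lra).
  repeat split; try lra.
  apply Rle_trans with v; [|lra].
  rewrite <- Hpsi; apply versin_of_sin_le; lra.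
- rewrite He, Hpsi; apply Rle_trans with (1 := HvP).
  apply (truncated_solution_ge_tail d a f h y xi); auto; lra.
Qed.

(** Once matched at [u0] with the explicit branch of sine [c u + h u], a
    truncated solution coincides with that branch on [[0, u0]].  It then vanishes
    at [0], is positive on [(0, 1)], and solves the equation without cut-off. *)
Lemma matched_truncated_solution (d c : R) (a f h y : R -> R) (u0 : R) :
  0 < d < 1 -> 0 < c -> 0 < u0 < 1 -> (forall u, continuous h u) -> h 0 = 0 ->
  (forall u, 0 < u < 1 -> is_derive h u (a u)) ->
  (forall u, 0 < u < 1 -> 0 <= a u) ->
  (forall u, 0 <= u <= u0 -> f u = 0) -> (forall u, u0 < u < 1 -> 0 < f u) ->
  truncated_solution d (fun u => c + a u) f y ->
  (forall u, u0 <= u <= 1 -> y u <= 1 - d) ->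
  y u0 = versin_of_sin (c * u0 + h u0) -> c * u0 + h u0 < 1 ->
  y 0 = 0 /\
  forall u, 0 < u < 1 ->
    0 < y u < 1 /\ is_derive y u ((c + a u) * tan_of_versin (y u) - f u).
Proof.
intros Hd Hc Hu0 Ch h0 Dh Pa f0 Pf Hy Hcap Hyu0 Hs.
assert (Mh := nondecreasing_of_derive_nonneg h a Ch Dh Pa).
assert (Pf' : forall u, 0 < u < 1 -> 0 <= f u).
{ intros u Hu; destruct (Rle_dec u u0) as [H|H].
  - right; symmetry; apply f0; lra.
  - left; apply Pf; lra. }
assert (Hk : forall u, 0 <= u <= u0 -> c * u <= c * u + h u <= c * u0 + h u0).
{ intros u Hu.
  assert (0 <= h u) by (rewrite <- h0; apply Mh; lra).
  assert (h u <= h u0) by (apply Mh; lra).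
  assert (c * u <= c * u0) by (apply Rmult_le_compat_l; lra); lra. }
assert (Hcu : forall u, 0 <= u -> 0 <= c * u)
  by (intros; apply Rmult_le_pos; lra).
assert (Hpsi : forall u, 0 <= u <= u0 -> versin_of_sin (c * u + h u) <= 1 - d).
{ intros u Hu; apply Rle_trans with (y u0); [|apply Hcap; lra].
  rewrite Hyu0; specialize (Hk u Hu); specialize (Hcu u ltac:(lra)).
  apply versin_of_sin_le; lra. }
assert (Hleft : forall u, 0 <= u <= u0 -> y u = versin_of_sin (c * u + h u)).
{ apply (truncated_solution_eq_versin_of_sin d (fun u => c + a u) f
           (fun u => c * u + h u) y 0 u0); auto; try lra.
  - intros u Hu; specialize (Pa u Hu); lra.
  - intros t Ht; apply f0; lra.
  - intros t; apply (continuous_plus (fun t => c * t) h); auto.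
    apply @ex_derive_continuous; auto_derive; auto.
  - intros t Ht; apply (is_derive_plus (fun t => c * t) h); auto.
    auto_derive; auto; ring.
  - intros t Ht; specialize (Hk t Ht); specialize (Hcu t ltac:(lra)).
    repeat split; try lra; auto. }
split; [rewrite Hleft, Rmult_0_r, h0, Rplus_0_l by lra; apply versin_of_sin_0|].
intros u Hu.
assert (Hpos : 0 < y u).
{ destruct (Rle_dec u u0) as [H|H].
  - rewrite Hleft by lra; rewrite <- versin_of_sin_0; specialize (Hk u ltac:(lra)).
    assert (0 < c * u) by (apply Rmult_lt_0_compat; lra).
    apply versin_of_sin_lt; lra.
  - apply (truncated_solution_pos d (fun u => c + a u) f y); auto.
    apply Pf; lra. }
assert (Hle : y u <= 1 - d).
{ destruct (Rle_dec u u0) as [H|H].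
  - rewrite Hleft by lra; apply Hpsi; lra.
  - apply Hcap; lra. }
split; [lra|].
rewrite <- (trunc_tan_id d) by lra; now apply Hy.
Qed.

(** The level [1 - d] is chosen so that the solutions of all speeds [c >= 0]
    stay below it on [[u0, 1]]: it is at least [P], and [1/d] is so large that
    the tangent term, with coefficient at least the minimum [m > 0] of [a] on
    [[u0, xi]], dominates the bound [M] of [f].  It is also at least [h u0], and
    so is the corresponding sine [sqrt (1 - d ^ 2)]; hence the speed [c1] at
    which the explicit branch reaches it at [u0] is nonnegative. *)
Lemma positive_speed_exists (f a h : R -> R) (u0 xi v : R) :
  0 < u0 -> u0 <= xi -> xi < 1 ->
  (forall u, continuous f u) -> (forall u, continuous a u) ->
  (forall u, continuous h u) -> h 0 = 0 ->
  (forall u, 0 < u < 1 -> is_derive h u (a u)) ->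
  (forall u, 0 < u < 1 -> 0 < a u) ->
  (forall u, 0 <= u <= u0 -> f u = 0) -> (forall u, u0 < u < 1 -> 0 < f u) ->
  RInt f xi 1 < 1 -> 0 <= v ->
  v <= RInt f xi 1 - (h 1 - h xi) * tan_of_versin (RInt f xi 1) ->
  h xi < sqrt (v * (2 - v)) ->
  exists (c : R) (y : R -> R), 0 < c /\ (forall u, continuous y u) /\
    y 0 = 0 /\ y 1 = 0 /\
    forall u, 0 < u < 1 ->
      0 < y u < 1 /\ is_derive y u ((c + a u) * tan_of_versin (y u) - f u).
Proof.
intros Hu0 Hxi Hxi1 Cf Ca Ch h0 Dh Pa f0 Pf HP Hv HvP Hhv.
set (P := RInt f xi 1) in *.
assert (HP0 : 0 < P).
{ apply RInt_gt_0; auto; intros; apply Pf; lra. }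
assert (Pa' : forall u, 0 < u < 1 -> 0 <= a u) by (intros; left; auto).
assert (Pf' : forall u, 0 < u < 1 -> 0 <= f u).
{ intros u Hu; destruct (Rle_dec u u0) as [H|H].
  - right; symmetry; apply f0; lra.
  - left; apply Pf; lra. }
assert (Mh := nondecreasing_of_derive_nonneg h a Ch Dh Pa').
assert (Hg : 0 <= tan_of_versin P) by (apply tan_of_versin_nonneg; lra).
assert (Hv1 : v <= P).
{ generalize (Mh xi 1); intros; nra. }
set (sv := sqrt (v * (2 - v))) in *.
assert (Hsv1 : sv < 1).
{ unfold sv; rewrite <- sqrt_1; apply sqrt_lt_1_alt; nra. }
assert (Hhu0 : 0 <= h u0 <= h xi).
{ split; [rewrite <- h0|]; apply Mh; lra. }
destruct (continuity_ab_min a u0 xi Hxi) as [mx [Hm Hmx]].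
{ intros; apply continuity_pt_filterlim, Ca. }
set (m := a mx) in *.
assert (Hm0 : 0 < m) by (apply Pa; lra).
destruct (bounded_on_segment f 0 1) as [M [HM Bf]]; [lra|auto|].
assert (Hq : 0 < m / (M + m)) by (apply Rdiv_lt_0_compat; lra).
set (d := Rmin (1 - P) (Rmin (1 - h u0) (m / (M + m)))).
assert (Hd1 : d <= 1 - P) by apply Rmin_l.
assert (Hd2 : d <= 1 - h u0)
  by (eapply Rle_trans; [apply Rmin_r|apply Rmin_l]).
assert (Hd3 : d <= m / (M + m))
  by (eapply Rle_trans; [apply Rmin_r|apply Rmin_r]).
assert (Hd : 0 < d < 1).
{ split; [|lra]; repeat apply Rmin_glb_lt; lra. }
clearbody d.
assert (HMg : M <= m * tan_of_versin (1 - d)).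
{ apply Rle_trans with (m * (/ d - 1)).
  2: apply Rmult_le_compat_l; [lra|now apply tan_of_versin_lower_bound].
  apply Rinv_le_contravar in Hd3; [|lra].
  replace (/ (m / (M + m))) with (M / m + 1) in Hd3 by (field; lra).
  replace M with (m * (M / m)) by (field; lra).
  apply Rmult_le_compat_l; lra. }
assert (HY : exists Y : R -> R -> R, forall c, 0 <= c ->
             truncated_solution d (fun u => c + a u) f (Y c)).
{ assert (H : forall c, exists y, 0 <= c ->
              truncated_solution d (fun u => c + a u) f y).
  { intros c; destruct (Rle_dec 0 c) as [Hc|Hc].
    - destruct (truncated_solution_exists d (fun u => c + a u) f) as [y Hy]; auto.
      + intros u; apply (continuous_plus (fun _ => c) a); auto.
        apply continuous_const.
      + intros u Hu; specialize (Pa u Hu); lra.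
      + exists y; auto.
    - exists (fun _ => 0); intros; contradiction. }
  exists (fun c => proj1_sig (constructive_indefinite_description _ (H c))).
  intros c; exact (proj2_sig (constructive_indefinite_description _ (H c))). }
destruct HY as [Y HY].
assert (PA : forall c, 0 <= c -> forall u, 0 < u < 1 -> 0 <= c + a u).
{ intros c Hc u Hu; specialize (Pa u Hu); lra. }
assert (Hcap : forall c, 0 <= c -> forall u, u0 <= u <= 1 -> Y c u <= 1 - d).
{ intros c Hc.
  apply (truncated_solution_le_cap d m M (fun u => c + a u) f (Y c) u0 xi);
    auto; try lra.
  - intros t Ht; specialize (Hm t ltac:(lra)); lra.
  - intros t Ht; apply Rle_trans with (1 := Rle_abs _); apply Bf; lra.
  - fold P; lra. }
set (c1 := (sqrt (1 - d ^ 2) - h u0) / u0).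
assert (Hc1u0 : c1 * u0 + h u0 = sqrt (1 - d ^ 2)) by (unfold c1; field; lra).
assert (Hs1 : 1 - d <= sqrt (1 - d ^ 2)).
{ rewrite <- (sqrt_square (1 - d)) by lra; apply sqrt_le_1_alt; nra. }
assert (Hs2 : sqrt (1 - d ^ 2) < 1).
{ rewrite <- sqrt_1 at 2; apply sqrt_lt_1_alt; nra. }
assert (Hpsi1 : versin_of_sin (sqrt (1 - d ^ 2)) = 1 - d).
{ unfold versin_of_sin; rewrite pow2_sqrt by nra.
  replace (1 - (1 - d ^ 2)) with (d * d) by ring; rewrite sqrt_square; lra. }
assert (Hc1 : 0 <= c1) by (apply Rdiv_le_0_compat; lra).
set (Phi := fun t => Y (Rmax 0 t) u0 - versin_of_sin (t * u0 + h u0)).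
assert (HPhi0 : 0 < Phi 0).
{ unfold Phi; rewrite Rmax_left, Rmult_0_l, Rplus_0_l by lra.
  set (e := sv - h xi); assert (He : e = sv - h xi) by reflexivity; clearbody e.
  assert (Hlow : versin_of_sin (h u0 + e) <= Y 0 u0).
  { apply (zero_speed_lower_bound d a f h (Y 0) u0 xi v); auto; fold P; fold sv; try lra.
    destruct (HY 0 (Rle_refl 0)) as [C0 [Y01 D0]]; split; [|split]; auto.
    intros u Hu; generalize (D0 u Hu); now rewrite Rplus_0_l. }
  assert (versin_of_sin (h u0) < versin_of_sin (h u0 + e))
    by (apply versin_of_sin_lt; lra).
  lra. }
assert (HPhi1 : Phi c1 <= 0).
{ unfold Phi; rewrite Rmax_right, Hc1u0, Hpsi1 by lra.
  generalize (Hcap c1 Hc1 u0); lra. }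
assert (CPhi : Ranalysis1.continuity Phi).
{ intros t; apply continuity_pt_filterlim.
  apply (continuous_minus (fun t => Y (Rmax 0 t) u0)
                          (fun t => versin_of_sin (t * u0 + h u0))).
  - apply lipschitz_continuous with (tan_of_versin (1 - d)); intros s s'.
    assert (Hs := Rmax_l 0 s); assert (Hs' := Rmax_l 0 s').
    apply Rle_trans with (tan_of_versin (1 - d) * Rabs (Rmax 0 s - Rmax 0 s')).
    + apply (truncated_solution_lipschitz_speed d _ _ a f); auto; lra.
    + apply Rmult_le_compat_l; [apply tan_of_versin_nonneg; lra|].
      unfold Rmax, Rabs; repeat destruct Rle_dec; repeat destruct Rcase_abs; lra.
  - apply (continuous_comp (fun t => t * u0 + h u0) versin_of_sin).
    + apply @ex_derive_continuous; auto_derive; auto.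
    + apply versin_of_sin_continuous. }
destruct (IVT_gen Phi 0 c1 0 CPhi) as [c [Hc HPhic]].
{ rewrite Rmin_right, Rmax_left by lra; lra. }
rewrite Rmin_left, Rmax_right in Hc by lra.
assert (Hc0 : 0 < c).
{ destruct (Req_dec c 0) as [->|H]; lra. }
assert (Hyu0 : Y c u0 = versin_of_sin (c * u0 + h u0)).
{ unfold Phi in HPhic; rewrite Rmax_right in HPhic; lra. }
assert (HYc := HY c ltac:(lra)).
assert (Hsine : c * u0 + h u0 < 1).
{ assert (c * u0 <= c1 * u0) by (apply Rmult_le_compat_r; lra); lra. }
destruct (matched_truncated_solution d c a f h (Y c) u0)
  as [Yc0 HYode]; auto; try lra.
{ apply Hcap; lra. }
exists c, (Y c); repeat (split; [auto; apply HYc|]); auto.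
Qed.

(** * From the unit interval to the real line and back *)

Lemma D_in_is_derive (f df : R -> R) (u : R) :
  0 < u < 1 -> D_in f df I01 u -> is_derive f u (df u).
Proof.
intros Hu HD; apply is_derive_Reals; intros e He.
destruct (HD e He) as [r [Hr H]].
assert (Hd : 0 < Rmin r (Rmin u (1 - u))) by (repeat apply Rmin_glb_lt; lra).
exists (mkposreal _ Hd); simpl; intros t Ht Htr.
apply Rmin_Rgt in Htr; destruct Htr as [H1 H2].
apply Rmin_Rgt in H2; destruct H2 as [H2 H3].
apply Rabs_def2 in H2; apply Rabs_def2 in H3.
specialize (H (u + t)); simpl in H; unfold R_dist, D_x, I01 in H.
replace (u + t - u) with t in H by ring.
apply H; repeat split; lra.
Qed.

Lemma D_in_continuous_on (f df : R -> R) :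
  (forall u, I01 u -> D_in f df I01 u) -> continuous_on I01 f.
Proof.
intros HD u Hu; apply filterlim_locally; intros e.
destruct (cont_deriv f df I01 u (HD u Hu) e (cond_pos e)) as [r [Hr H]].
exists (mkposreal r Hr); intros x Hx Ix; simpl in *.
destruct (Req_dec u x) as [->|Hux]; [apply ball_center|].
apply (H x); repeat split; auto; apply Ix.
Qed.

(** Composing the data with the projection onto [[0, 1]] makes them continuous on
    the whole line without changing the equation on [(0, 1)]. *)
Lemma admissible_speed_exists (f h : R -> R) (u0 xi v : R) :
  C1_01 f -> type_B f u0 -> C1_01 h -> h 0 = 0 ->
  (forall u, 0 < u < 1 -> 0 < Derive h u) ->
  u0 <= xi < 1 -> RInt f xi 1 < 1 -> 0 <= v ->
  v <= RInt f xi 1 - (h 1 - h xi) * tan_of_versin (RInt f xi 1) ->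
  h xi < sqrt (v * (2 - v)) ->
  exists c, 0 < c /\ admissible h f c.
Proof.
intros [df [Df _]] [Hu0 [f0 [fpos f1]]] [dh [Dh Cdh]] h0 Hinc Hxi HP Hv HvP Hhv.
set (cl := clamp 0 1).
assert (Hcl : forall u, 0 <= u <= 1 -> cl u = u)
  by (intros; now apply clamp_id).
assert (Hderive : forall u, 0 < u < 1 -> is_derive h u (dh u)).
{ intros u Hu; apply D_in_is_derive; auto; apply Dh; red; lra. }
assert (HDer : forall u, 0 < u < 1 -> Derive h u = dh u)
  by (intros; now apply is_derive_unique, Hderive).
assert (HRI : RInt (fun u => f (cl u)) xi 1 = RInt f xi 1).
{ apply RInt_ext; rewrite Rmin_left, Rmax_right by lra.
  intros t Ht; now rewrite Hcl by lra. }
destruct (positive_speed_exists (fun u => f (cl u)) (fun u => dh (cl u))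
            (fun u => h (cl u)) u0 xi v)
  as [c [y [Hc [Cy [y0 [y1 Hy]]]]]]; rewrite ?HRI, ?Hcl; try lra.
- apply continuous_clamp_comp, D_in_continuous_on with df; auto.
- apply continuous_clamp_comp; auto.
- apply continuous_clamp_comp, D_in_continuous_on with dh; auto.
- intros u Hu; rewrite Hcl by lra.
  apply is_derive_ext_loc with h; [|now apply Hderive].
  generalize (filter_and _ _ (open_gt 0 u (proj1 Hu)) (open_lt 1 u (proj2 Hu))).
  apply filter_imp; intros t [H1 H2]; now rewrite Hcl by lra.
- intros u Hu; rewrite Hcl, <- HDer by lra; auto.
- intros u Hu; rewrite Hcl by lra; auto.
- intros u Hu; rewrite Hcl by lra; auto.
- exists c; split; auto; exists y; split; [|split; [|split; [|split]]]; auto.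
  + intros u _; apply filterlim_filter_le_1 with (2 := Cy u), filter_le_within.
  + intros u Hu; rewrite HDer by auto.
    destruct (Hy u Hu) as [_ D]; rewrite !Hcl in D by lra; exact D.
  + intros u Hu; apply Hy; auto.
Qed.

(** In both cases [v] lies strictly below the lower bound of the solution of
    speed zero at [xi], and the hypotheses on [h] are, after clearing the
    tangent, exactly the two inequalities required on [v].  In the second case
    the two bounds on [h] to the left of [xi0] add up to one on [h xi0]. *)
Theorem proposition4p2 (f h : R -> R) (u0 eta : R)
  (f_C1 : C1_01 f) (f_B : type_B f u0)
  (h_C1 : C1_01 h) (h_0 : h 0 = 0)
  (h_incr : forall u, 0 < u < 1 -> 0 < Derive h u)
  (h_u0 : h u0 < 1 + h 0)
  (eta_pos : 0 < eta) (eta_lt : eta < Rmin (Fplus f u0) 1) :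
  (Fplus f u0 < 1 ->
   h u0 - h 0 < sqrt (1 - (1 + eta - Fplus f u0) ^ 2) ->
   h 1 - h u0 <
     (1 - Fplus f u0) / sqrt (Fplus f u0 * (2 - Fplus f u0)) * eta ->
   exists c : R, 0 < c /\ admissible h f c)
  /\
  (forall kappa xi0 : R,
   1 <= Fplus f u0 ->
   0 < kappa < eta ->
   u0 < xi0 < 1 ->
   RInt f xi0 1 = 1 - kappa ->
   h u0 - h 0 < sqrt (1 - eta ^ 2) ->
   h xi0 - h u0 < sqrt (1 - ((kappa + eta) / 2) ^ 2) - sqrt (1 - eta ^ 2) ->
   h 1 - h xi0 < (eta - kappa) / 2 * (kappa / sqrt (1 - kappa ^ 2)) ->
   exists c : R, 0 < c /\ admissible h f c).
Proof.
assert (Hu0 : 0 < u0 < 1) by apply f_B.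
apply Rmin_Rgt in eta_lt; destruct eta_lt as [eta_F eta_1].
split.
- unfold Fplus in *; set (F := RInt f u0 1) in *; intros HF Hh0 Hh1.
  apply admissible_speed_exists with (u0 := u0) (xi := u0) (v := F - eta);
    auto; fold F; try lra.
  + assert (Hs : 0 < sqrt (F * (2 - F))) by (apply sqrt_lt_R0; nra).
    assert (Hg : 0 < tan_of_versin F) by (apply Rdiv_lt_0_compat; lra).
    apply Rmult_lt_compat_r with (r := tan_of_versin F) in Hh1; auto.
    replace ((1 - F) / sqrt (F * (2 - F)) * eta * tan_of_versin F) with eta in Hh1
      by (unfold tan_of_versin; field; lra).
    lra.
  + replace ((F - eta) * (2 - (F - eta))) with (1 - (1 + eta - F) ^ 2) by ring.
    lra.
- intros kappa xi0 _ Hk Hxi HI Hh0 Hhxi Hh1.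
  apply admissible_speed_exists with (u0 := u0) (xi := xi0)
    (v := 1 - (kappa + eta) / 2); auto; rewrite ?HI; try lra.
  + assert (Hs : 0 < sqrt (1 - kappa ^ 2)) by (apply sqrt_lt_R0; nra).
    assert (Hg : tan_of_versin (1 - kappa) = sqrt (1 - kappa ^ 2) / kappa)
      by (unfold tan_of_versin; f_equal; [f_equal|]; ring).
    assert (Hg0 : 0 < sqrt (1 - kappa ^ 2) / kappa)
      by (apply Rdiv_lt_0_compat; lra).
    rewrite Hg.
    apply Rmult_lt_compat_r with (1 := Hg0) in Hh1.
    replace ((eta - kappa) / 2 * (kappa / sqrt (1 - kappa ^ 2))
             * (sqrt (1 - kappa ^ 2) / kappa))
      with ((eta - kappa) / 2) in Hh1 by (field; lra).
    lra.
  + replace ((1 - (kappa + eta) / 2) * (2 - (1 - (kappa + eta) / 2)))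
      with (1 - ((kappa + eta) / 2) ^ 2) by ring.
    lra.
Qed.
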